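(* Let $(X,J_1,J_2,J_3)$ and $(M,I_1,I_2,I_3)$ be almost hypercomplex manifolds and let $u:X\to M$ be a smooth map. Then $u$ is aholomorphic if and only if the quaternion-linear component of its differential $u_*$ vanishes at each point of $X$.
   Context: An almost hypercomplex manifold $(M,I_1,I_2,I_3)$ is a smooth manifold with three almost complex structures satisfying $I_1I_2=-I_2I_1=I_3$, so that each tangent space is a quaternionic vector space. A smooth map $u:X\to M$ is called aholomorphic if it satisfies the Cauchy–Riemann–Fueter equation $$I_1u_*J_1+I_2u_*J_2+I_3u_*J_3=u_*$$ at every point. For quaternionic vector spaces $(U,J_1,J_2,J_3)$, $(V,I_1,I_2,I_3)$, the group $Sp(1)$ of unit quaternions acts on $U$ and $V$ by quaternionic multiplication and on $\mathrm{Hom}_{\mathbb R}(U,V)$ by $q\cdot A=qAq^{-1}$; the invariant subspace is the space $\mathrm{Hom}_{\mathbb H}(U,V)$ of quaternion-linear maps ($AJ_l=I_lA$, $l=1,2,3$). The quaternion-linear component of $A\in\mathrm{Hom}_{\mathbb R}(U,V)$ is its projection to $\mathrm{Hom}_{\mathbb H}(U,V)$ along the unique $Sp(1)$-invariant complement of $\mathrm{Hom}_{\mathbb H}(U,V)$. *)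

(* Defs.v *)
From HB Require Import structures.
From mathcomp Require Import all_boot all_order all_algebra.
From mathcomp Require Import all_classical all_reals all_analysis.
Import Order.TTheory GRing.Theory Num.Theory.
Import numFieldNormedType.Exports.

Set Implicit Arguments.
Unset Strict Implicit.
Unset Printing Implicit Defensive.

Local Open Scope classical_set_scope.
Local Open Scope ring_scope.

Section Smoothness.
Context {R : realType} {n m : nat}.

(* C^k on an open set A: f is C^(k+1) iff it is differentiable and all its
   directional derivatives are C^k.  Values of f outside A are irrelevant. *)
Fixpoint Ck (k : nat) (A : set 'cV[R]_n) (f : 'cV[R]_n -> 'cV[R]_m) : Prop :=
  if k is k'.+1 then
    (forall x, A x -> differentiable f x) /\ (forall v, Ck k' A ('D_v f))
  else forall x, A x -> {for x, continuous f}.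

Definition smooth_on (A : set 'cV[R]_n) (f : 'cV[R]_n -> 'cV[R]_m) : Prop :=
  forall k, Ck k A f.

End Smoothness.

(* A homeomorphism from the open set [chart_dom] onto the open set [chart_img];
   [chart_map] and [chart_inv] are meaningless outside these sets. *)
Record chart (R : realType) (n : nat) (T : topologicalType) := Chart {
  chart_dom : set T;
  chart_img : set 'cV[R]_n;
  chart_map : T -> 'cV[R]_n;
  chart_inv : 'cV[R]_n -> T;
  chart_dom_open : open chart_dom;
  chart_img_open : open chart_img;
  chart_map_fun : set_fun chart_dom chart_img chart_map;
  chart_inv_fun : set_fun chart_img chart_dom chart_inv;
  chart_mapK : forall x, chart_dom x -> chart_inv (chart_map x) = x;
  chart_invK : forall y, chart_img y -> chart_map (chart_inv y) = y;
  chart_map_cont : {within chart_dom, continuous chart_map};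
  chart_inv_cont : {within chart_img, continuous chart_inv}
}.

Record manifold (R : realType) (n : nat) := Manifold {
  manifold_top :> topologicalType;
  manifold_hausdorff : hausdorff_space manifold_top;
  manifold_second_countable : @second_countable manifold_top;
  atlas : set (chart R n manifold_top);
  atlas_cover : forall x, exists2 c, atlas c & chart_dom c x;
  atlas_smooth : forall c d, atlas c -> atlas d ->
    smooth_on (chart_img c `&` chart_inv c @^-1` chart_dom d)
      (chart_map d \o chart_inv c)
}.

Section Tangent.
Context {R : realType}.

Definition chart_at {n} (X : manifold R n) (x : X) : chart R n X :=
  s2val (cid2 (atlas_cover x)).

(* A tangent vector at x is represented by its coordinates in [chart_at x]. *)
Definition tangent {n} (X : manifold R n) (x : X) : vectType R := 'cV[R]_n.

Definition smooth_map {n m} (X : manifold R n) (M : manifold R m)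
    (u : X -> M) : Prop :=
  continuous u /\
  forall c d, atlas c -> atlas d ->
    smooth_on (chart_img c `&` (u \o chart_inv c) @^-1` chart_dom d)
      (chart_map d \o u \o chart_inv c).

Definition differential {n m} (X : manifold R n) (M : manifold R m)
    (u : X -> M) (x : X) : 'Hom(tangent x, tangent (u x)) :=
  linfun ('d (chart_map (chart_at (u x)) \o u \o chart_inv (chart_at x))
             (chart_map (chart_at x) x)).

(* The expression, at the point of coordinates y in the chart c, of a field of
   endomorphisms of the tangent spaces in the coordinates of c (rather than in
   those of the chart selected by [chart_at]). *)
Definition field_in_chart {n} (X : manifold R n)
    (J : forall x : X, 'End(tangent x)) (c : chart R n X)
    (y : 'cV[R]_n) : 'End('cV[R]_n) :=
  let x := chart_inv c y in
  (linfun ('d (chart_map c \o chart_inv (chart_at x))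
              (chart_map (chart_at x) x))
   \o J x
   \o linfun ('d (chart_map (chart_at x) \o chart_inv c) y))%VF.

Definition smooth_field {n} (X : manifold R n)
    (J : forall x : X, 'End(tangent x)) : Prop :=
  forall c, atlas c -> forall v : 'cV[R]_n,
    smooth_on (chart_img c) (fun y => field_in_chart J c y v).

End Tangent.

Record quaternion (R : realType) := Quaternion { qr : R; qi : R; qj : R; qk : R }.

Definition unit_quaternion {R : realType} (q : quaternion R) : Prop :=
  qr q ^+ 2 + qi q ^+ 2 + qj q ^+ 2 + qk q ^+ 2 = 1.

(* The inverse of q when q is a unit quaternion. *)
Definition qconj {R : realType} (q : quaternion R) : quaternion R :=
  Quaternion (qr q) (- qi q) (- qj q) (- qk q).

Record quaternionic (R : realType) (V : vectType R) := Quaternionic {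
  I1 : 'End(V);
  I2 : 'End(V);
  I3 : 'End(V);
  I1_sqr : (I1 \o I1)%VF = - \1%VF;
  I2_sqr : (I2 \o I2)%VF = - \1%VF;
  I3_sqr : (I3 \o I3)%VF = - \1%VF;
  I1I2 : (I1 \o I2)%VF = I3;
  I2I1 : - (I2 \o I1)%VF = I3
}.

Section QuaternionLinearComponent.
Context {R : realType} {U V : vectType R}.

Definition qmul {E : vectType R} (I : quaternionic E) (q : quaternion R) :
    'End(E) :=
  qr q *: \1%VF + qi q *: I1 I + qj q *: I2 I + qk q *: I3 I.

Context (J : quaternionic U) (I : quaternionic V).

Definition Sp1_act (q : quaternion R) (A : 'Hom(U, V)) : 'Hom(U, V) :=
  (qmul I q \o A \o qmul J (qconj q))%VF.

Definition Sp1_invariant (W : {vspace 'Hom(U, V)}) : Prop :=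
  forall q, unit_quaternion q -> forall A, A \in W -> Sp1_act q A \in W.

(* The space of quaternion-linear maps; see [HomHP]. *)
Definition HomH : {vspace 'Hom(U, V)} :=
  (lker (linfun (fun A : 'Hom(U, V) => (A \o I1 J)%VF - (I1 I \o A)%VF)) :&:
   lker (linfun (fun A : 'Hom(U, V) => (A \o I2 J)%VF - (I2 I \o A)%VF)) :&:
   lker (linfun (fun A : 'Hom(U, V) => (A \o I3 J)%VF - (I3 I \o A)%VF)))%VS.

Lemma memv_ker_comm (E : 'End(U)) (F : 'End(V)) (A : 'Hom(U, V)) :
  (A \in lker (linfun (fun A : 'Hom(U, V) => (A \o E)%VF - (F \o A)%VF)))
  = ((A \o E)%VF == (F \o A)%VF).
Proof.
pose f (B : 'Hom(U, V)) := (B \o E)%VF - (F \o B)%VF.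
have lf : linear f.
  move=> a B C; rewrite /f comp_lfunDl comp_lfunDr -comp_lfunZl -comp_lfunZr.
  by rewrite scalerBr opprD addrACA.
pose fL := GRing.isLinear.Build _ _ _ _ f lf.
pose g : {linear 'Hom(U, V) -> 'Hom(U, V)} := HB.pack f fL.
by rewrite memv_ker (lfunE g) /= /f subr_eq0.
Qed.

Lemma HomHP (A : 'Hom(U, V)) :
  reflect [/\ (A \o I1 J = I1 I \o A)%VF, (A \o I2 J = I2 I \o A)%VF
            & (A \o I3 J = I3 I \o A)%VF]
          (A \in HomH).
Proof.
rewrite !memv_cap !memv_ker_comm; apply: (iffP andP).
  by case=> /andP[/eqP ? /eqP ?] /eqP ?.
by case=> -> -> ->; rewrite !eqxx.
Qed.

Definition Sp1_complement (W : {vspace 'Hom(U, V)}) : Prop :=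
  [/\ Sp1_invariant W, (HomH + W)%VS = fullv & (HomH :&: W)%VS = 0%VS].

(* The unique Sp(1)-invariant complement of [HomH]. *)
Definition HomH_compl : {vspace 'Hom(U, V)} :=
  xget 0%VS [set W | Sp1_complement W].

Definition qlin_component (A : 'Hom(U, V)) : 'Hom(U, V) :=
  daddv_pi HomH HomH_compl A.

End QuaternionLinearComponent.

Record almost_hypercomplex (R : realType) (n : nat) (X : manifold R n) :=
  AlmostHypercomplex {
  quat_at :> forall x : X, quaternionic (tangent x);
  I1_smooth : smooth_field (fun x => I1 (quat_at x));
  I2_smooth : smooth_field (fun x => I2 (quat_at x));
  I3_smooth : smooth_field (fun x => I3 (quat_at x))
}.

Definition aholomorphic {R : realType} {n m : nat}
    (X : manifold R n) (M : manifold R m)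
    (J : almost_hypercomplex X) (I : almost_hypercomplex M)
    (u : X -> M) : Prop :=
  forall x, let du := differential u x in
    (I1 (I (u x)) \o du \o I1 (J x))%VF
    + (I2 (I (u x)) \o du \o I2 (J x))%VF
    + (I3 (I (u x)) \o du \o I3 (J x))%VF = du.

(* Main.v *)
(** The map [A |-> A - I1 A J1 - I2 A J2 - I3 A J3] is four times the average of
    [q A q^-1] over [q = 1, i, j, k].  It takes values in the quaternion-linear
    maps, is multiplication by 4 on them, kills every invariant complement, and
    is itself invariant under [Sp(1)], so that its kernel is such a complement.
    Hence it is four times the quaternion-linear component, and the
    Cauchy-Riemann-Fueter equation says that it vanishes at [u_*]. *)

Require Import Defs.
From HB Require Import structures.
From mathcomp Require Import all_boot all_order all_algebra.
From mathcomp Require Import all_classical all_reals all_analysis.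
From mathcomp Require Import ring.

Import GRing.Theory Num.Theory.

Local Open Scope ring_scope.

Section QuaternionRelations.
Context {R : realType} {V : vectType R} (I : quaternionic V).

(** The whole multiplication table follows from the three squares and [I1 I2 = I3 = - I2 I1]. It is
    packed into one tuple so that a single [rewrite] reduces every product of two units. *)
Lemma quaternionicE (v : V) :
  ((I1 I (I1 I v) = - v) * (I1 I (I2 I v) = I3 I v) * (I1 I (I3 I v) = - I2 I v)) *
  ((I2 I (I1 I v) = - I3 I v) * (I2 I (I2 I v) = - v) * (I2 I (I3 I v) = I1 I v)) *
  ((I3 I (I1 I v) = I2 I v) * (I3 I (I2 I v) = - I1 I v) * (I3 I (I3 I v) = - v)).
Proof.
have e11 w : I1 I (I1 I w) = - w by rewrite -comp_lfunE I1_sqr opp_lfunE id_lfunE.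
have e22 w : I2 I (I2 I w) = - w by rewrite -comp_lfunE I2_sqr opp_lfunE id_lfunE.
have e33 w : I3 I (I3 I w) = - w by rewrite -comp_lfunE I3_sqr opp_lfunE id_lfunE.
have e12 w : I1 I (I2 I w) = I3 I w by rewrite -comp_lfunE I1I2.
have e21 w : I2 I (I1 I w) = - I3 I w by rewrite -(I2I1 I) opp_lfunE comp_lfunE opprK.
have e13 w : I1 I (I3 I w) = - I2 I w by rewrite -e12 e11.
have e23 w : I2 I (I3 I w) = I1 I w.
  have -> : I3 I w = - I2 I (I1 I w) by rewrite e21 opprK.
  by rewrite linearN /= e22 opprK.
have e31 w : I3 I (I1 I w) = I2 I w by rewrite -e12 e21 linearN /= e13 opprK.
have e32 w : I3 I (I2 I w) = - I1 I w by rewrite -e12 e22 linearN.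
by do !split.
Qed.

Lemma qmulE (q : quaternion R) (v : V) :
  qmul I q v = qr q *: v + qi q *: I1 I v + qj q *: I2 I v + qk q *: I3 I v.
Proof. by rewrite !(add_lfunE, scale_lfunE) id_lfunE. Qed.

Lemma qmul_conj_unit (q : quaternion R) :
  unit_quaternion q -> (qmul I (qconj q) \o qmul I q)%VF = \1%VF.
Proof.
case: q => a b c d; rewrite /unit_quaternion /= => hq.
apply/lfunP => v; rewrite comp_lfunE id_lfunE !qmulE /=.
rewrite !(linearD, linearZ) /= !quaternionicE.
rewrite !(scalerDr, scalerN, scalerA) -!(@scaleNr _ V) !addrA.
(* The sixteen terms are grouped as multiples of [v], [I1 I v], [I2 I v] and [I3 I v]. The last
   three coefficients cancel, and the first is the squared norm of [q]. *)
rewrite [LHS](ACl ((1*6*11*16)*(2*5*12*15)*(3*8*9*14)*(4*7*10*13))) /= -!scalerDl.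
rewrite [X in X *: I1 I v](_ : _ = 0); last by ring.
rewrite [X in X *: I2 I v](_ : _ = 0); last by ring.
rewrite [X in X *: I3 I v](_ : _ = 0); last by ring.
rewrite !scale0r !addr0 -[RHS]scale1r -hq; congr (_ *: v); ring.
Qed.

End QuaternionRelations.

Section Fueter.
Context {R : realType} {U V : vectType R}.
Context (J : quaternionic U) (I : quaternionic V).

Definition fueter (A : 'Hom(U, V)) : 'Hom(U, V) :=
  A - (I1 I \o A \o I1 J)%VF - (I2 I \o A \o I2 J)%VF - (I3 I \o A \o I3 J)%VF.

Lemma fueterE (A : 'Hom(U, V)) (v : U) :
  fueter A v = A v - I1 I (A (I1 J v)) - I2 I (A (I2 J v)) - I3 I (A (I3 J v)).
Proof. by rewrite !(add_lfunE, opp_lfunE, comp_lfunE). Qed.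

Lemma fueter_is_linear : linear fueter.
Proof.
move=> a A B; apply/lfunP => v.
rewrite !(fueterE, add_lfunE, scale_lfunE) !(linearD, linearZ) /= !scalerN.
by rewrite [LHS](AC (2*2*2*2) ((1*3*5*7)*(2*4*6*8))).
Qed.

HB.instance Definition _ := GRing.isLinear.Build R 'Hom(U, V) 'Hom(U, V) _ fueter
  fueter_is_linear.

(** Composing with a unit of [J] on the right or with the same unit of [I] on the left yields the
    same four terms in a different order. *)
Lemma fueter_HomH (A : 'Hom(U, V)) : fueter A \in HomH J I.
Proof.
by apply/HomHP; split; apply/lfunP => v; rewrite !comp_lfunE !fueterE;
  rewrite !(linearD, linearN) /= !quaternionicE !linearN ?opprK;
  [rewrite [LHS](ACl (2*1*4*3)) | rewrite [LHS](ACl (3*4*1*2))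
  | rewrite [LHS](ACl (4*3*2*1))].
Qed.

(** Each unit passes through [A] and squares to [-1], so all four summands equal [A]. *)
Lemma fueter_qlin (A : 'Hom(U, V)) : A \in HomH J I -> fueter A = 4 *: A.
Proof.
case/HomHP => h1 h2 h3; apply/lfunP => v; rewrite fueterE scale_lfunE.
rewrite -[I1 I _]comp_lfunE -[I2 I _]comp_lfunE -[I3 I _]comp_lfunE -h1 -h2 -h3.
by rewrite !comp_lfunE !quaternionicE !linearN !opprK scaler_nat !mulrS addr0 !addrA.
Qed.

(* Checking the three imaginary units suffices, since both sides are linear in [q]. *)
Lemma fueter_qmul (q : quaternion R) (A : 'Hom(U, V)) :
  fueter (qmul I q \o A)%VF = fueter (A \o qmul J q)%VF.
Proof.
have h1 : fueter (I1 I \o A)%VF = fueter (A \o I1 J)%VF.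
  apply/lfunP => v; rewrite !fueterE !comp_lfunE !quaternionicE !linearN ?opprK.
  by rewrite [LHS](ACl (2*1*4*3)).
have h2 : fueter (I2 I \o A)%VF = fueter (A \o I2 J)%VF.
  apply/lfunP => v; rewrite !fueterE !comp_lfunE !quaternionicE !linearN ?opprK.
  by rewrite [LHS](ACl (3*4*1*2)).
have h3 : fueter (I3 I \o A)%VF = fueter (A \o I3 J)%VF.
  apply/lfunP => v; rewrite !fueterE !comp_lfunE !quaternionicE !linearN ?opprK.
  by rewrite [LHS](ACl (4*3*2*1)).
rewrite /qmul !(comp_lfunDl, comp_lfunDr) -!(comp_lfunZl, comp_lfunZr).
by rewrite comp_lfun1l comp_lfun1r !(linearD, linearZ) /= h1 h2 h3.
Qed.

(** The left factor [q] moves to the far right, where it cancels against the conjugate of [q]. *)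
Lemma fueter_Sp1_act (q : quaternion R) (A : 'Hom(U, V)) :
  unit_quaternion q -> fueter (Sp1_act J I q A) = fueter A.
Proof.
by move=> hq; rewrite /Sp1_act -comp_lfunA fueter_qmul -comp_lfunA qmul_conj_unit //
  comp_lfun1r.
Qed.

Lemma mem_lker_fueter (A : 'Hom(U, V)) : (A \in lker (linfun fueter)) = (fueter A == 0).
Proof. by rewrite memv_ker lfunE. Qed.

Lemma Sp1_complement_lker_fueter : Sp1_complement J I (lker (linfun fueter)).
Proof.
split.
- by move=> q hq A; rewrite !mem_lker_fueter fueter_Sp1_act.
- apply/eqP; rewrite eqEsubv subvf; apply/subvP => A _.
  (* A quarter of [fueter] is the identity on [HomH], so subtracting it from [A] leaves an element
     of the kernel. *)
  rewrite -[A](subrKC (4^-1 *: fueter A)) memv_add ?memvZ ?fueter_HomH //.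
  rewrite mem_lker_fueter linearB linearZ /= (fueter_qlin _ (fueter_HomH _)).
  by rewrite scalerK ?pnatr_eq0 // subrr.
- apply/eqP; rewrite -subv0; apply/subvP => A.
  rewrite memv_cap mem_lker_fueter memv0 => /andP[/fueter_qlin ->].
  by rewrite scaler_eq0 pnatr_eq0.
Qed.

(** The three subtracted terms, with their signs, are the images of [A] under the unit quaternions
    i, j and k. *)
Lemma fueter_Sp1_invariant (W : {vspace 'Hom(U, V)}) (A : 'Hom(U, V)) :
  Sp1_invariant J I W -> A \in W -> fueter A \in W.
Proof.
move=> hW AW.
have h1 : - (I1 I \o A \o I1 J)%VF \in W.
  have -> : - (I1 I \o A \o I1 J)%VF = Sp1_act J I (Quaternion 0 1 0 0) A.
    by apply/lfunP => v; rewrite opp_lfunE !comp_lfunE !qmulE /=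
      ?(oppr0, scaleNr, scale0r, scale1r, addr0, add0r) !linearN.
  by apply: hW => //; rewrite /unit_quaternion /=; ring.
have h2 : - (I2 I \o A \o I2 J)%VF \in W.
  have -> : - (I2 I \o A \o I2 J)%VF = Sp1_act J I (Quaternion 0 0 1 0) A.
    by apply/lfunP => v; rewrite opp_lfunE !comp_lfunE !qmulE /=
      ?(oppr0, scaleNr, scale0r, scale1r, addr0, add0r) !linearN.
  by apply: hW => //; rewrite /unit_quaternion /=; ring.
have h3 : - (I3 I \o A \o I3 J)%VF \in W.
  have -> : - (I3 I \o A \o I3 J)%VF = Sp1_act J I (Quaternion 0 0 0 1) A.
    by apply/lfunP => v; rewrite opp_lfunE !comp_lfunE !qmulE /=
      ?(oppr0, scaleNr, scale0r, scale1r, addr0, add0r) !linearN.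
  by apply: hW => //; rewrite /unit_quaternion /=; ring.
by rewrite /fueter !memvD.
Qed.

Lemma fueter_qlin_component (A : 'Hom(U, V)) : fueter A = 4 *: qlin_component J I A.
Proof.
(* The kernel of [fueter] witnesses existence, so [xget] returns a genuine complement and not its
   default [0]. *)
have [inv full triv] : Sp1_complement J I (HomH_compl J I).
  exact: (xgetPex _ (ex_intro _ _ Sp1_complement_lker_fueter)).
have AHW : A \in (HomH J I + HomH_compl J I)%VS by rewrite full memvf.
rewrite -{1}(daddv_pi_add triv AHW) linearD /= (fueter_qlin _ (memv_pi _ _ _)).
(* For the component [w] of [A] in the complement, [fueter w] is both quaternion-linear and in the
   complement, hence zero. *)
set w := daddv_pi _ (HomH J I) A.
have : fueter w \in (HomH J I :&: HomH_compl J I)%VS.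
  by rewrite memv_cap fueter_HomH fueter_Sp1_invariant // memv_pi.
by rewrite triv memv0 => /eqP ->; rewrite addr0.
Qed.

(** This is the pointwise form of the theorem, obtained by dividing by 4. *)
Lemma qlin_component_eq0 (A : 'Hom(U, V)) :
  qlin_component J I A = 0 <->
  (I1 I \o A \o I1 J)%VF + (I2 I \o A \o I2 J)%VF + (I3 I \o A \o I3 J)%VF = A.
Proof.
have -> : qlin_component J I A = 0 <-> fueter A = 0.
  split=> [h|/eqP]; first by rewrite fueter_qlin_component h scaler0.
  by rewrite fueter_qlin_component scaler_eq0 pnatr_eq0 => /eqP.
rewrite /fueter -!addrA -!opprD addrA; split=> [/subr0_eq <-//|->].
exact: subrr.
Qed.

End Fueter.

Theorem theorem2p6 (R : realType) (n m : nat)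
    (X : manifold R n) (M : manifold R m)
    (J : almost_hypercomplex X) (I : almost_hypercomplex M)
    (u : X -> M) (hu : smooth_map u) :
  aholomorphic J I u <->
  forall x : X, qlin_component (J x) (I (u x)) (differential u x) = 0.
Proof. by split=> h x; apply/qlin_component_eq0; apply: h. Qed.
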